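(* Let $\mathcal{A}$ be a set of propositional atoms (attributes) containing pairwise distinct atoms $a,b,c,d,x,y$, and let $K=\{a\wedge b\rightarrow x,\; c\wedge d\rightarrow x,\; a\wedge c\rightarrow y,\; b\wedge d\rightarrow y\}$. Then $K$ cannot be simulated by the embedding strategy $(\phi_{\mathrm{avg}},\psi_{\mathrm{dist}})$. That is, there do not exist an integer $m\geq 1$, vectors $\mathbf{p},\tilde{\mathbf{p}}\in\mathbb{R}^m$ and thresholds $\theta_p\geq 0$ (for $p\in\mathcal{A}$) such that for every $q\in\mathcal{A}$ and every non-empty finite set $\{p_1,\dots,p_n\}\subseteq\mathcal{A}$ of $n$ distinct attributes: $$q\in \mathrm{Lab}_{\mathrm{dist}}(\mathrm{Emb}_{\mathrm{avg}}(p_1,\dots,p_n)) \iff K\models p_1\wedge\dots\wedge p_n\rightarrow q .$$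
   Context: Each attribute $p\in\mathcal{A}$ is assigned two vectors $\mathbf{p},\tilde{\mathbf{p}}\in\mathbb{R}^m$ (possibly different) and a threshold $\theta_p\geq 0$; the dimension $m$ may be chosen arbitrarily. The embedding function is $\mathrm{Emb}_{\mathrm{avg}}(p_1,\dots,p_n)=\frac1n(\mathbf{p}_1+\dots+\mathbf{p}_n)$ and the labelling function is $\mathrm{Lab}_{\mathrm{dist}}(\mathbf{e})=\{q\in\mathcal{A} \mid d(\mathbf{e},\tilde{\mathbf{q}})\leq\theta_q\}$ for $\mathbf{e}\in\mathbb{R}^m$, where $d$ is Euclidean distance. The symbol $\models$ denotes standard propositional entailment over the atoms $\mathcal{A}$. *)

(* Defs.v *)
From mathcomp Require Import all_boot all_order all_algebra.
From mathcomp Require Import classical_sets reals.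
From Stdlib Require List.

Set Implicit Arguments.
Unset Strict Implicit.
Unset Printing Implicit Defensive.

Import Order.TTheory GRing.Theory Num.Theory.

Local Open Scope ring_scope.
Local Open Scope classical_set_scope.

Inductive formula (A : Type) : Type :=
| Atom of A
| Top
| Bot
| Neg of formula A
| And of formula A & formula A
| Or of formula A & formula A
| Imp of formula A & formula A.

Arguments Top {A}.
Arguments Bot {A}.

Fixpoint eval (A : Type) (v : A -> bool) (f : formula A) : bool :=
  match f with
  | Atom p => v p
  | Top => true
  | Bot => false
  | Neg g => ~~ eval v g
  | And g h => eval v g && eval v h
  | Or g h => eval v g || eval v h
  | Imp g h => eval v g ==> eval v h
  end.

Definition entails (A : Type) (K : set (formula A)) (f : formula A) : Prop :=
  forall v : A -> bool, (forall g, K g -> eval v g) -> eval v f.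

(* The conjunction is nested to the right and ends in Top. *)
Definition conj_atoms (A : Type) (n : nat) (p : 'I_n -> A) : formula A :=
  \big[@And A/Top]_(i < n) Atom (p i).

(* The norm that MathComp-Analysis puts on row vectors is the sup norm, hence
   an explicit Euclidean distance. *)
Definition edist (R : realType) (m : nat) (u v : 'rV[R]_m) : R :=
  Num.sqrt (\sum_(i < m) (u 0 i - v 0 i) ^+ 2).

Definition Emb_avg (R : realType) (A : Type) (m : nat) (vec : A -> 'rV[R]_m)
    (n : nat) (p : 'I_n -> A) : 'rV[R]_m :=
  n%:R^-1 *: \sum_(i < n) vec (p i).

Definition Lab_dist (R : realType) (A : Type) (m : nat)
    (tvec : A -> 'rV[R]_m) (theta : A -> R) (e : 'rV[R]_m) : set A :=
  [set q | edist e (tvec q) <= theta q].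

(* A non-empty finite set of n distinct attributes is given by an injective
   enumeration p : 'I_n -> A with 0 < n, so that no decidable equality on A is
   needed. *)
Definition simulates (R : realType) (A : Type) (m : nat)
    (vec tvec : A -> 'rV[R]_m) (theta : A -> R) (K : set (formula A)) : Prop :=
  forall (q : A) (n : nat) (p : 'I_n -> A), (0 < n)%N -> injective p ->
    Lab_dist tvec theta (Emb_avg vec p) q <->
    entails K (Imp (conj_atoms p) (Atom q)).

Definition K_rules (A : Type) (a b c d x y : A) : set (formula A) :=
  [set Imp (And (Atom a) (Atom b)) (Atom x);
       Imp (And (Atom c) (Atom d)) (Atom x);
       Imp (And (Atom a) (Atom c)) (Atom y);
       Imp (And (Atom b) (Atom d)) (Atom y)].

(* Main.v *)
Require Import Defs.
From mathcomp Require Import all_boot all_order all_algebra.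
From mathcomp Require Import classical_sets reals.
From mathcomp Require Import boolp ring lra.
From Stdlib Require List.

Import Order.TTheory GRing.Theory Num.Theory.

Local Open Scope ring_scope.

(** Since the midpoints satisfy [ab + cd = ac + bd], for every point [z]
    [d(ab,z)^2 + d(cd,z)^2 - d(ac,z)^2 - d(bd,z)^2 = <a - d, b - c> / 2],
    independently of [z].  The ball of [x] contains [ab] and [cd] but neither
    [ac] nor [bd], so [<a - d, b - c> < 0]; the ball of [y], with [b] and [c]
    exchanged, gives [<a - d, c - b> < 0], a contradiction. *)

Lemma edist_sqr {R : realType} {m : nat} (u v : 'rV[R]_m) :
  edist u v ^+ 2 = \sum_(i < m) (u 0 i - v 0 i) ^+ 2.
Proof. by rewrite sqr_sqrtr // sumr_ge0 // => i _; exact: sqr_ge0. Qed.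

Lemma edist_midpoints {R : realType} {m : nat} (a b c d z : 'rV[R]_m) :
  edist (2^-1 *: (a + b)) z ^+ 2 + edist (2^-1 *: (c + d)) z ^+ 2
  - (edist (2^-1 *: (a + c)) z ^+ 2 + edist (2^-1 *: (b + d)) z ^+ 2)
  = 2^-1 * \sum_(i < m) (a 0 i - d 0 i) * (b 0 i - c 0 i).
Proof.
rewrite !edist_sqr -!big_split /= -sumrB mulr_sumr.
by apply: eq_bigr => i _; rewrite !mxE; field.
Qed.

(** Distances and [t] are nonnegative, so the four comparisons survive squaring. The left side of
    [edist_midpoints] is then at most [2 * t ^+ 2] minus something larger than [2 * t ^+ 2]. *)
Lemma midpoints_separated_dot_lt0 {R : realType} {m : nat}
    (a b c d z : 'rV[R]_m) (t : R) :
  0 <= t ->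
  edist (2^-1 *: (a + b)) z <= t -> edist (2^-1 *: (c + d)) z <= t ->
  ~ edist (2^-1 *: (a + c)) z <= t -> ~ edist (2^-1 *: (b + d)) z <= t ->
  \sum_(i < m) (a 0 i - d 0 i) * (b 0 i - c 0 i) < 0.
Proof.
move=> t0 ab cd /negP; rewrite -ltNge => ac /negP; rewrite -ltNge => bd.
have := edist_midpoints a b c d z; set S := \sum_(i < m) _.
have le2 u : edist u z <= t -> edist u z ^+ 2 <= t ^+ 2.
  by move=> ut; rewrite lerXn2r ?nnegrE // sqrtr_ge0.
have lt2 u : t < edist u z -> t ^+ 2 < edist u z ^+ 2.
  by move=> tu; rewrite ltrXn2r ?nnegrE // sqrtr_ge0.
move: (le2 _ ab) (le2 _ cd) (lt2 _ ac) (lt2 _ bd).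
by move=> *; lra.
Qed.

(** Only two-element attribute sets are needed: their averages are the midpoints of the geometric
    argument. *)
Lemma simulates_pair {R : realType} {A : Type} {m : nat}
    {vec tvec : A -> 'rV[R]_m} {theta : A -> R} {K : set (formula A)}
    {p q : A} (z : A) :
  simulates vec tvec theta K -> p <> q ->
  edist (2^-1 *: (vec p + vec q)) (tvec z) <= theta z <->
  entails K (Imp (And (Atom p) (Atom q)) (Atom z)).
Proof.
move=> sim pq; pose f (i : 'I_2) := if i == ord0 then p else q.
have f_inj : injective f.
  move=> i j; rewrite /f.
  (* Equal indices are closed by [val_inj]; for distinct ones, [H] would identify [p] with [q]. *)
  by case: i j => [[|[|//]] ?] [[|[|//]] ?] //= H;
    first [exact: val_inj | case: pq].
have := sim z 2%N f isT f_inj.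
rewrite /Lab_dist /Emb_avg /conj_atoms !big_ord_recl !big_ord0 addr0 /=.
(* [andbT] removes the [Top] that ends the conjunction. *)
by rewrite /entails /= => ->; split=> H v /H; rewrite andbT.
Qed.

Lemma simulates_dot_lt0 {R : realType} {A : Type} {a b c d x y : A}
    {m : nat} {vec tvec : A -> 'rV[R]_m} {theta : A -> R} :
  List.NoDup [:: a; b; c; d; x; y] -> 0 <= theta x ->
  simulates vec tvec theta (K_rules a b c d x y) ->
  \sum_(i < m) (vec a 0 i - vec d 0 i) * (vec b 0 i - vec c 0 i) < 0.
Proof.
move=> nd t0 sim.
have [ab [ac [bd cd]]] : a <> b /\ a <> c /\ b <> d /\ c <> d.
  by move: nd; rewrite !List.NoDup_cons_iff /=; intuition.
apply: (midpoints_separated_dot_lt0 _ _ _ _ (tvec x) (theta x)) => //;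
  rewrite (simulates_pair _ sim) //.
- by move=> v vK; apply: vK; do 3 left.
- by move=> v vK; apply: vK; do 2 left; right.
(* Countermodel: exactly [a], [c], [y] are true. By distinctness, each of the two rules for [x] has
   a false premise, [y] holds, and [x] fails. *)
- move=> /(_ (fun p => `[< List.In p [:: a; c; y] >])) /=; apply/not_implyP.
  by split; [move=> g [[[->|->]|->]|->] /= | ];
    rewrite -?asbool_and -?asbool_imply; move: nd;
    rewrite !List.NoDup_cons_iff asboolE /=; intuition congruence.
(* The mirror countermodel, with exactly [b], [d], [y] true. *)
- move=> /(_ (fun p => `[< List.In p [:: b; d; y] >])) /=; apply/not_implyP.
  by split; [move=> g [[[->|->]|->]|->] /= | ];
    rewrite -?asbool_and -?asbool_imply; move: nd;
    rewrite !List.NoDup_cons_iff asboolE /=; intuition congruence.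
Qed.

Theorem mainTheorem2 (R : realType) (A : Type) (a b c d x y : A)
    (hdistinct : List.NoDup [:: a; b; c; d; x; y]) :
  ~ exists (m : nat) (vec tvec : A -> 'rV[R]_m) (theta : A -> R),
      [/\ (1 <= m)%N,
          forall p : A, 0 <= theta p
        & simulates vec tvec theta (K_rules a b c d x y)].
Proof.
case=> m [vec [tvec [theta [_ t0 sim]]]].
have ltx := simulates_dot_lt0 hdistinct (t0 x) sim.
(* Exchanging [b] with [c] and [x] with [y] only permutes the four rules, so [simulates_dot_lt0]
   also applies to the ball of [y]. *)
have swap : K_rules a b c d x y = K_rules a c b d y x.
  by apply/seteqP; split=> g [[[->|->]|->]|->];
    rewrite /K_rules /setU /set1 /=; tauto.
have hswap : List.NoDup [:: a; c; b; d; y; x].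
  by move: hdistinct; rewrite !List.NoDup_cons_iff /=; intuition.
rewrite swap in sim.
have lty := simulates_dot_lt0 hswap (t0 y) sim.
(* The exchange flips the sign of the second factor, so the two sums are opposite and cannot both be
   negative. *)
move: lty; suff -> : \sum_(i < m) (vec a 0 i - vec d 0 i) * (vec c 0 i - vec b 0 i)
       = - \sum_(i < m) (vec a 0 i - vec d 0 i) * (vec b 0 i - vec c 0 i).
  by rewrite oppr_lt0 ltNge (ltW ltx).
by rewrite -sumrN; apply: eq_bigr => i _; ring.
Qed.
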